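(* Let $(\Omega,\Sigma,\mu)$ be a positive measure space with $\mu(\Omega)<\infty$ and let $\mathcal{F}\subseteq L_2(\Omega,\mu;\mathbb{R})$ be a class of proper functions of the form $\mathcal{F}=\{f+\mathcal{N}_f: f\in\mathcal{F}_0\}$ described in the context, built from a non-increasing sequence $\sigma_1\ge\sigma_2\ge\cdots\ge0$ in $\ell_2(\mathbb{N})$. Then $$\kappa^{+}_{n}(\mathcal{F};\mu)\le 2\sqrt{\mu(\Omega)}\,\Big(\sum_{j=n}^{\infty}\sigma_j^2\Big)^{1/2}\quad\text{for all } n\in\mathbb{N}.$$
   Context: For $n\in\mathbb{N}$, the Tchakaloff quadrature width is $$\kappa^{+}_n(\mathcal{F};\mu):=\inf_{\substack{x_1,\ldots,x_n\in\Omega\\ \mu_1,\ldots,\mu_n\ge0}}\ \sup_{f\in\mathcal{F}}\Big|\int_\Omega f(x)\,\mathrm{d}\mu(x)-\sum_{j=1}^n\mu_jf(x_j)\Big|.$$ Form of the class $\mathcal{F}$. Let $\sigma_1\ge\sigma_2\ge\cdots\ge0$ be a non-increasing sequence of real numbers with $\sum_j\sigma_j^2<\infty$, let $J:=\{j\in\mathbb{N}:\sigma_j>0\}$, and let $\{\eta_j\}_{j\in J}$ be an orthonormal system in $L_2(\Omega,\mu;\mathbb{R})$ consisting of proper functions $\Omega\to\mathbb{R}$. Put $$\mathcal{F}_0:=\Big\{\sum_{j\in J}c_j\eta_j:\ \{c_j\}_{j\in J}\subset\mathbb{R},\ \sum_{j\in J}\Big(\frac{c_j}{\sigma_j}\Big)^2\le1\Big\}.$$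 Here each sum is understood as a proper real-valued function on $\Omega$ that agrees with the (absolutely convergent) pointwise series at every $x\in\Omega$ with $\sum_{j\in J}\sigma_j^2\eta_j(x)^2<\infty$, i.e. outside a $\mu$-null set; on that null set it is whatever representative has been fixed. Further, let $\mathcal{N}\subseteq\Omega$ be a fixed $\mu$-null set, and for each $f\in\mathcal{F}_0$ let $\mathcal{N}_f$ be a set of $\mu$-measurable functions $g:\Omega\to\mathbb{R}$ vanishing outside $\mathcal{N}$. Then $\mathcal{F}:=\{f+\mathcal{N}_f: f\in\mathcal{F}_0\}$, meaning the collection of all functions $f+d$ with $f\in\mathcal{F}_0$ and $d\in\mathcal{N}_f$. *)

(* Defs.v *)
From HB Require Import structures.
From mathcomp Require Export all_boot all_order all_algebra.
From mathcomp Require Export all_classical all_reals all_analysis.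
Set Implicit Arguments.
Unset Strict Implicit.
Unset Printing Implicit Defensive.
Export Order.TTheory GRing.Theory Num.Theory.
Export numFieldNormedType.Exports.
Local Open Scope classical_set_scope.
Local Open Scope ring_scope.

(* The points are elements of a [measurableType], which is inhabited by
   convention, so the infimum is never over an empty set of quadratures.  The
   integral is extended-real valued: a non-integrable [f] gives error [+oo]. *)
Definition tchakaloff_width (d : measure_display) (T : measurableType d)
    (R : realType) (mu : {measure set T -> \bar R}) (F : set (T -> R))
    (n : nat) : \bar R :=
  ereal_inf [set e | exists (x : 'I_n -> T) (w : 'I_n -> R),
    (forall j, 0 <= w j) /\
    e = ereal_sup [set `| \int[mu]_y (f y)%:E
                          - (\sum_(j < n) w j * f (x j))%:E |%E | f in F] ].

(* "mu-measurable" refers to the completion of the sigma-algebra, so that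
   functions altered arbitrarily on a null set are allowed.  The library's
   integral, a supremum over simple functions below the integrand, still agrees
   for such functions with the integral against the completed measure. *)
Definition mu_measurable (d : measure_display) (T : measurableType d)
    (R : realType) (mu : {measure set T -> \bar R}) (f : T -> R) : Prop :=
  exists2 g : T -> R, measurable_fun [set: T] g & ae_eq mu [set: T] f g.

(* Proper functions (not classes) whose a.e. class lies in L_2. *)
Definition L2fun (d : measure_display) (T : measurableType d)
    (R : realType) (mu : {measure set T -> \bar R}) : set (T -> R) :=
  [set f | exists2 g : T -> R, g \in Lfun mu 2%:E & ae_eq mu [set: T] f g].

(* Sequences indexed by {1, 2, ...} are functions on [nat] whose value at 0 is
   never used. *)
Definition supp_idx (R : realType) (sigma : nat -> R) (j : nat) : bool :=
  (0 < j)%N && (0 < sigma j).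

Definition orthonormal_system (d : measure_display) (T : measurableType d)
    (R : realType) (mu : {measure set T -> \bar R}) (J : pred nat)
    (eta : nat -> T -> R) : Prop :=
  (forall j, J j -> L2fun mu (eta j)) /\
  (forall i j, J i -> J j ->
    (\int[mu]_x (eta i x * eta j x)%:E)%E = ((i == j)%:R)%:E).

(* A family (c_j) indexed by J is encoded by its extension by 0 to [nat], so
   that distinct elements of the ball are distinct families. *)
Definition coef_ball (R : realType) (sigma : nat -> R) : set (nat -> R) :=
  [set c | (forall j, ~~ supp_idx sigma j -> c j = 0) /\
    (\sum_(0 <= j <oo | supp_idx sigma j) ((c j / sigma j) ^+ 2)%:E <= 1)%E].

Definition good_points (T : Type) (R : realType) (sigma : nat -> R)
    (eta : nat -> T -> R) : set T :=
  [set x | (\sum_(0 <= j <oo | supp_idx sigma j)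
              (sigma j ^+ 2 * eta j x ^+ 2)%:E < +oo)%E].

(* [rep c] is the function denoted by the sum of the c_j eta_j: the pointwise
   sum at good points, and an arbitrary but fixed choice elsewhere. *)
Definition fixes_representatives (T : Type) (R : realType)
    (sigma : nat -> R) (eta : nat -> T -> R)
    (rep : (nat -> R) -> T -> R) : Prop :=
  forall c x, coef_ball sigma c -> good_points sigma eta x ->
    (\sum_(0 <= j < m | supp_idx sigma j) c j * eta j x) @[m --> \oo]
      --> rep c x.

Definition class0 (T : Type) (R : realType) (sigma : nat -> R)
    (rep : (nat -> R) -> T -> R) : set (T -> R) :=
  [set rep c | c in coef_ball sigma].

Definition perturbed_class (T : Type) (R : realType) (F0 : set (T -> R))
    (Nf : (T -> R) -> set (T -> R)) : set (T -> R) :=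
  \bigcup_(f in F0) [set f \+ g | g in Nf f].

(* Main.v *)
Require Import Defs.
From mathcomp Require Import measurable_realfun ring lra.
Set Implicit Arguments.
Unset Strict Implicit.
Unset Printing Implicit Defensive.
Local Open Scope classical_set_scope.
Local Open Scope ring_scope.

(** Fix [n] and let [h] be the square root of the tail kernel
    [sum_(j >= n) sigma_j^2 eta_j^2].  If [f = sum_j c_j eta_j] is in the class,
    Cauchy-Schwarz gives [|f - sum_(j < n) c_j eta_j| <= h] off a null set.  A
    quadrature with nonnegative weights that is exact on [eta_1, ..., eta_(n-1)]
    and on [h] therefore makes an error of at most
    [int h + sum_j w_j h(x_j) = 2 int h], and [int h] is at most
    [sqrt (mu Omega) * (sum_(j >= n) sigma_j^2)^(1/2)] by Cauchy-Schwarz in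
    [L_2].  These are [n] conditions, which is why [n] nodes suffice: only the
    cone generated by the point evaluations in [R^n] matters, and every element
    of it is a combination of [n] generators ([conic_caratheodory]).

    Since the width is an infimum, the quadrature need only be exact up to an
    arbitrarily small error, so it is enough that the vector of moments lies in
    the closure of that cone ([moments_in_cone_closure]).  For an approximate
    minimiser [c] of the distance from the cone to the moment vector [v],
    comparing [c] with [c + t phi(x)] bounds [<v - c, phi(x)>] from above for
    every [x], and integrating that bound over [x] bounds [<v - c, v>] from
    above; comparing [c] with its multiples bounds [<v - c, c>] from below.  The
    difference of the two inner products is [|v - c|^2], which is thus
    arbitrarily small.

    The exactness error on [eta_j] is multiplied by [|c_j| <= sigma_1], so it is
    uniformly small over the class.  The functions of the class are only almost
    everywhere equal to measurable ones; [integral_version] passes to the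
    measurable versions, and nodes are kept outside a common null set on which
    the versions, the series or the perturbations could misbehave. *)

(** * Conic combinations *)

(** More rows than columns means a linear relation [u] between the rows of [A];
    moving the weights along [- u] keeps the combination, and the first weight
    to reach zero determines how far to move. *)
Lemma nonneg_combination_drop (R : realFieldType) (m n : nat)
    (A : 'M[R]_(m, n)) (w : 'rV[R]_m) :
  (n < m)%N -> (forall i, 0 <= w 0 i) ->
  exists (i0 : 'I_m) (w' : 'rV[R]_m),
    [/\ forall i, 0 <= w' 0 i, w' 0 i0 = 0 & w' *m A = w *m A].
Proof.
move=> nm w0.
have [u uA [i1 ui1]] : exists2 u : 'rV[R]_m, u *m A = 0 & exists i, 0 < u 0 i.
  have /rowV0Pn[u /sub_kermxP uA u0] : kermx A != 0.
    by rewrite kermx_eq0 neq_ltn (leq_ltn_trans (rank_leq_col A) nm).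
  have /rV0Pn[i ui] := u0.
  have [ui0|ui0] := ltP 0 (u 0 i); first by exists u => //; exists i.
  exists (- u); first by rewrite mulNmx uA oppr0.
  by exists i; rewrite mxE oppr_gt0 lt_neqAle ui ui0.
pose i0 := [arg min_(i < i1 | 0 < u 0 i) (w 0 i / u 0 i)]%O.
have [ui0 i0min] : 0 < u 0 i0 /\
    forall i, 0 < u 0 i -> w 0 i0 / u 0 i0 <= w 0 i / u 0 i.
  by rewrite /i0; case: Order.TotalTheory.arg_minP.
have t0 : 0 <= w 0 i0 / u 0 i0 by rewrite divr_ge0// ltW.
exists i0, (w - (w 0 i0 / u 0 i0) *: u); split=> [i||].
- rewrite !mxE subr_ge0; have [ui|ui] := ltP 0 (u 0 i).
    by rewrite -ler_pdivlMr// i0min.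
  exact: le_trans (mulr_ge0_le0 t0 ui) (w0 i).
- by rewrite !mxE divfK ?subrr ?gt_eqF.
- by rewrite mulmxBl -scalemxAl uA scaler0 subr0.
Qed.

Lemma nonneg_combination_pad (R : realFieldType) (T : pointedType)
    (V : lmodType R) (n m : nat) (phi : T -> V) (x : 'I_m -> T) (w : 'I_m -> R) :
  (m <= n)%N -> (forall i, 0 <= w i) ->
  exists (y : 'I_n -> T) (v : 'I_n -> R), (forall j, 0 <= v j) /\
    \sum_j v j *: phi (y j) = \sum_i w i *: phi (x i).
Proof.
move=> /subnKC <- w0; set k := (n - m)%N.
exists (fun j : 'I_(m + k) => if fintype.split j is inl i then x i else point).
exists (fun j : 'I_(m + k) => if fintype.split j is inl i then w i else 0).
split=> [j|]; first by case: (fintype.split j).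
rewrite big_split_ord/= [X in _ + X]big1 ?addr0 => [|j _].
  by apply: eq_bigr => i _; rewrite (unsplitK (inl i)).
by rewrite (unsplitK (inr j)) scale0r.
Qed.

Lemma conic_caratheodory (R : realFieldType) (T : pointedType) (n m : nat)
    (phi : T -> 'rV[R]_n) (x : 'I_m -> T) (w : 'I_m -> R) :
  (forall i, 0 <= w i) ->
  exists (y : 'I_n -> T) (v : 'I_n -> R), (forall j, 0 <= v j) /\
    \sum_j v j *: phi (y j) = \sum_i w i *: phi (x i).
Proof.
elim: m x w => [|m IH] x w w0.
  exists (fun=> point), (fun=> 0); split=> //.
  by rewrite big_ord0 big1// => j _; rewrite scale0r.
have [mn|nm] := ltnP m n.
  exact: nonneg_combination_pad mn w0.
have [i0 [w' [w'0 w'i0 w'A]]] := @nonneg_combination_drop R m.+1 n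
  (\matrix_i phi (x i)) (\row_i w i) nm
  (fun i => eq_ind_r (>= 0) (w0 i) (mxE _ _ 0 i)).
have [y [v [v0 yv]]] := IH (x \o lift i0)
  (fun i => w' 0 (lift i0 i)) (fun i => w'0 _).
exists y, v; split=> //; rewrite yv.
move: w'A; rewrite !mulmx_sum_row (bigD1_ord i0)//= w'i0 scale0r add0r.
under eq_bigr do rewrite rowK; move=> ->.
by apply: eq_bigr => i _; rewrite mxE rowK.
Qed.

(** * Moments lie in the closure of the cone of point evaluations *)

(** Approximate minimality gives a quadratic inequality along every ray; the
    step [a / (p + b)] is the optimal one up to the shift [b], which keeps it
    defined for [p = 0] and, when [b = a], at most 1. *)
Lemma first_order_bound (R : realFieldType) (a b p s : R) :
  0 < a -> 0 < b -> 0 <= p ->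
  2 * (a / (p + b)) * s <= a ^+ 2 + (a / (p + b)) ^+ 2 * p ^+ 2 ->
  s <= a * (p + b).
Proof.
move=> a0 b0 p0; set t := a / (p + b) => ts.
have pb0 : 0 < p + b by rewrite ltr_wpDl.
have t0 : 0 < t by rewrite divr_gt0.
have ta : a = t * (p + b) by rewrite divfK ?gt_eqF.
have tp : t * p <= a by rewrite ta ler_pM2l// lerDl ltW.
have tp0 : 0 <= t * p by rewrite mulr_ge0// ltW.
have : 2 * t * s <= 2 * a * a.
  apply: le_trans ts _; rewrite -exprMn.
  have : (t * p) ^+ 2 <= a ^+ 2 by rewrite lerXn2r// nnegrE// ltW.
  nra.
rewrite {2}ta => ?; suff : 2 * t * s <= 2 * t * (a * (p + b)).
  by rewrite ler_pM2l// mulr_gt0.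
by apply: le_trans (_ : 2 * t * s <= _) _ => //; lra.
Qed.

Lemma sum_sqr_le_sqr_sum (R : realFieldType) (I : Type) (r : seq I) (a : I -> R) :
  \sum_(i <- r) a i ^+ 2 <= (\sum_(i <- r) `|a i|) ^+ 2.
Proof.
elim: r => [|i r IH]; first by rewrite !big_nil expr0n.
rewrite !big_cons sqrrD real_normK ?num_real// -addrA lerD2l.
apply: le_trans IH _; rewrite lerDr mulrn_wge0// mulr_ge0//.
exact: sumr_ge0.
Qed.

Lemma integrable_sum_EFin (d : measure_display) (T : measurableType d)
    (R : realType) (mu : {measure set T -> \bar R}) (I : Type) (r : seq I)
    (f : I -> T -> R) :
  (forall i, mu.-integrable [set: T] (EFin \o f i)) ->
  mu.-integrable [set: T] (EFin \o (fun x => \sum_(i <- r) f i x)).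
Proof.
move=> fi; apply: (@eq_integrable _ _ _ mu _ measurableT
  (fun x => (\sum_(i <- r) (EFin \o f i) x)%E)) => [x _|].
  by rewrite /= -sumEFin.
by apply: integrable_sum => // i _; exact: fi.
Qed.

Lemma Rintegral_sum (d : measure_display) (T : measurableType d)
    (R : realType) (mu : {measure set T -> \bar R}) (I : Type) (r : seq I)
    (f : I -> T -> R) :
  (forall i, mu.-integrable [set: T] (EFin \o f i)) ->
  \int[mu]_x (\sum_(i <- r) f i x) = \sum_(i <- r) \int[mu]_x f i x.
Proof.
move=> fi; elim: r => [|i r IH].
  by under eq_Rintegral do rewrite big_nil; rewrite big_nil Rintegral_cst// mul0r.
under eq_Rintegral do rewrite big_cons.
by rewrite big_cons RintegralD//; [rewrite IH | exact: integrable_sum_EFin].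
Qed.

(** The model for [C] is the set of moment vectors of finite quadratures with
    nonnegative weights; it enters through its invariance under adding a node
    and under rescaling the weights. *)
Section moments_in_cone_closure.
Context (R : realType) (d : measure_display) (T : measurableType d).
Variables (mu : {measure set T -> \bar R}) (n : nat) (phi : 'I_n -> T -> R).
Variable C : set ('I_n -> R).
Hypothesis phi_int : forall k, mu.-integrable [set: T] (EFin \o phi k).
Hypothesis C0 : C (fun=> 0).
Hypothesis C_add : forall c x t, C c -> 0 <= t -> C (fun k => c k + t * phi k x).
Hypothesis C_scale : forall c t, C c -> 0 <= t -> C (fun k => t * c k).

Let v k := \int[mu]_x phi k x.
Let q c := \sum_k (v k - c k) ^+ 2.

Let int_P : mu.-integrable [set: T] (EFin \o (fun x => \sum_k `|phi k x|)).
Proof. by apply: integrable_sum_EFin => k; exact: integrable_norm. Qed.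

(** An exact minimiser would satisfy [<v - c, phi x> <= 0] for every [x] and
    [<v - c, c> = 0]; minimality up to [a ^+ 2] weakens both by terms of order
    [a], with [t <= 1] needed to stay in the cone when [c] is shrunk. *)
Lemma near_minimiser_bound c a : C c -> 0 < a -> a <= 1 ->
  (forall c', C c' -> q c < q c' + a ^+ 2) ->
  q c <= a * (\int[mu]_x (\sum_k `|phi k x|) + \sum_k `|c k| + a).
Proof.
move=> Cc a0 a1 cmin.
have q_shift (e : 'I_n -> R) t : q (fun k => c k + t * e k) =
    q c - 2 * t * (\sum_k (v k - c k) * e k) + t ^+ 2 * \sum_k e k ^+ 2.
  rewrite /q !mulr_sumr -sumrB -big_split/=; apply: eq_bigr => k _; ring.
have pointwise x : \sum_k (v k - c k) * phi k x <= a * \sum_k `|phi k x|.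
  set P := \sum_k `|_|; have P0 : 0 <= P by exact: sumr_ge0.
  apply/ler_addgt0Pr => e e0; have b0 : 0 < e / a by rewrite divr_gt0.
  (* The arbitrary shift [e / a] covers the case [P = 0]. *)
  have -> : a * P + e = a * (P + e / a)
    by rewrite mulrDr mulrCA divff ?gt_eqF ?mulr1.
  apply: first_order_bound => //; set t := a / _.
  have t0 : 0 <= t by rewrite divr_ge0 ?addr_ge0// ltW.
  have := cmin _ (C_add x Cc t0); rewrite q_shift.
  have : t ^+ 2 * \sum_k phi k x ^+ 2 <= t ^+ 2 * P ^+ 2.
    by rewrite ler_wpM2l ?sqr_ge0// sum_sqr_le_sqr_sum.
  lra.
have radial : \sum_k (v k - c k) * - c k <= a * (\sum_k `|c k| + a).
  set Q := \sum_k `|_|; have Q0 : 0 <= Q by exact: sumr_ge0.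
  apply: first_order_bound => //; set t := a / _.
  have t1 : 0 <= 1 - t.
    by rewrite subr_ge0 ler_pdivrMr ?ltr_wpDl// mul1r lerDr.
  have := cmin _ (C_scale Cc t1).
  have -> : (fun k => (1 - t) * c k) = (fun k => c k + t * - c k).
    by apply/funext => k; ring.
  rewrite q_shift; under [X in _ ^+ 2 * X]eq_bigr do rewrite sqrrN.
  have : t ^+ 2 * \sum_k c k ^+ 2 <= t ^+ 2 * Q ^+ 2.
    by rewrite ler_wpM2l ?sqr_ge0// sum_sqr_le_sqr_sum.
  lra.
have mean : \sum_k (v k - c k) * v k <= a * \int[mu]_x (\sum_k `|phi k x|).
  have int_k k : mu.-integrable [set: T] (EFin \o (fun x => (v k - c k) * phi k x)).
    exact: (integrableZl measurableT (v k - c k) (phi_int k)).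
  rewrite -RintegralZl//.
  have -> : \sum_k (v k - c k) * v k = \int[mu]_x \sum_k (v k - c k) * phi k x.
    rewrite Rintegral_sum//; apply: eq_bigr => k _.
    exact: esym (RintegralZl _ _ _).
  apply: le_Rintegral => //.
  - exact: integrable_sum_EFin.
  - exact: (integrableZl measurableT a int_P).
have -> : q c = \sum_k (v k - c k) * v k + \sum_k (v k - c k) * - c k.
  by rewrite -big_split/=; apply: eq_bigr => k _; ring.
lra.
Qed.

(** The factor of [a] in [near_minimiser_bound] stays bounded along a minimising
    sequence, because [sum |c k|] is at most [sum |v k| + n + q c]. *)
Lemma moments_in_cone_closure eps : 0 < eps ->
  exists2 c, C c & forall k, `|\int[mu]_x phi k x - c k| <= eps.
Proof.
move=> eps0.
have q0 c : 0 <= q c by apply: sumr_ge0 => k _; exact: sqr_ge0.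
have q_inf : has_inf (q @` C).
  by split; [exists (q (fun=> 0)), (fun=> 0) | exists 0 => _ [c _ <-]].
pose A := \int[mu]_x (\sum_k `|phi k x|).
have A0 : 0 <= A by apply: Rintegral_ge0 => x _; exact: sumr_ge0.
pose V := \sum_k `|v k|; have V0 : 0 <= V by exact: sumr_ge0.
have D0 : 0 <= inf (q @` C) by apply: lb_le_inf => [|_ [c _ <-]//]; case: q_inf.
(* [K] bounds the factor of [a] in [near_minimiser_bound]. *)
pose K := A + (V + n%:R + inf (q @` C) + 1) + 1.
have n0 : 0 <= n%:R :> R by [].
have K0 : 0 < K by rewrite /K; lra.
pose a := Num.min 1 (eps ^+ 2 / K).
have a0 : 0 < a by rewrite lt_min ltr01 divr_gt0// exprn_gt0.
have a1 : a <= 1 by rewrite ge_min lexx.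
have [_ [c Cc <-] qc] := inf_adherent (exprn_gt0 2 a0) q_inf.
have cmin c' : C c' -> q c < q c' + a ^+ 2.
  move=> Cc'; apply: lt_le_trans qc _; rewrite lerD2r; apply: ge_inf.
    by case: q_inf.
  by exists c'.
have qca := near_minimiser_bound Cc a0 a1 cmin; rewrite -/A in qca.
have cV : \sum_k `|c k| <= V + n%:R + inf (q @` C) + 1.
  have -> : n%:R = \sum_(k < n) 1 :> R by rewrite sumr_const card_ord.
  have : q c <= inf (q @` C) + 1.
    by apply: le_trans (ltW qc) _; rewrite lerD2l expr_le1// ltW.
  suff : \sum_k `|c k| <= V + \sum_(k < n) 1 + q c by lra.
  rewrite -!big_split/=; apply: ler_sum => k _.
  have : `|c k| <= `|v k| + `|v k - c k|.
    by have := ler_normB (v k) (v k - c k); rewrite opprB addrC subrK.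
  by rewrite -(real_normK (num_real (v k - c k))); nra.
have qe : q c <= eps ^+ 2.
  apply: le_trans qca _; apply: (@le_trans _ _ (a * K)).
    by rewrite ler_pM2l// /K; lra.
  by rewrite -ler_pdivlMr// ge_min lexx orbT.
exists c => // k; rewrite -ler_sqr ?nnegrE ?(ltW eps0)//.
rewrite real_normK ?num_real//; apply: le_trans qe.
by rewrite /q (bigD1 k)//= lerDl sumr_ge0// => i _; exact: sqr_ge0.
Qed.

End moments_in_cone_closure.

(** Caratheodory's theorem for cones brings the nodes of an approximating
    quadrature down to the number of moments.  It is [n] rather than [n.+1]
    because the sum of the weights is not prescribed. *)
Lemma approximate_tchakaloff (R : realType) (d : measure_display)
    (T : measurableType d) (mu : {measure set T -> \bar R}) (n : nat)
    (phi : 'I_n -> T -> R) (eps : R) :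
  (forall k, mu.-integrable [set: T] (EFin \o phi k)) -> 0 < eps ->
  exists (x : 'I_n -> T) (w : 'I_n -> R), (forall j, 0 <= w j) /\
    forall k, `|\int[mu]_y phi k y - \sum_j w j * phi k (x j)| <= eps.
Proof.
move=> phi_int eps0.
pose C : set ('I_n -> R) := [set c |
  exists (m : nat) (x : 'I_m -> T) (w : 'I_m -> R),
    (forall j, 0 <= w j) /\ forall k, c k = \sum_j w j * phi k (x j)].
have C0 : C (fun=> 0).
  exists 0%N, (fun=> point), (fun=> 0); split=> // k; by rewrite big_ord0.
have C_add c x t : C c -> 0 <= t -> C (fun k => c k + t * phi k x).
  move=> [m [y [w [w0 cE]]]] t0.
  exists m.+1, (oapp y x \o unlift ord0), (oapp w t \o unlift ord0).
  split=> [j|k /=]; first by rewrite /=; case: unlift => /=.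
  rewrite big_ord_recl unlift_none/= addrC cE; congr (_ + _).
  by apply: eq_bigr => i _; rewrite liftK.
have C_scale c t : C c -> 0 <= t -> C (fun k => t * c k).
  move=> [m [y [w [w0 cE]]]] t0; exists m, y, (fun j => t * w j).
  split=> [j|k]; first by rewrite mulr_ge0.
  by rewrite cE mulr_sumr; apply: eq_bigr => j _; rewrite mulrA.
have [c [m [x [w [w0 cE]]]] ceps] :=
  moments_in_cone_closure phi_int C0 C_add C_scale eps0.
have [y [u [u0 yu]]] :=
  conic_caratheodory (fun z => \row_k phi k z) x w0.
exists y, u; split=> // k; have := ceps k; rewrite cE.
suff -> : \sum_j u j * phi k (y j) = \sum_j w j * phi k (x j) by [].
have /rowP/(_ k) := yu; rewrite !summxE.
under eq_bigr do rewrite !mxE.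
by under [X in _ = X -> _]eq_bigr do rewrite !mxE.
Qed.

(** * Cauchy-Schwarz inequalities and integrals of versions *)

Lemma sqr_le_of_nonneg_quadratic (R : realFieldType) (a b c : R) :
  0 <= c -> (forall t, 0 <= a - 2 * t * b + t ^+ 2 * c) -> b ^+ 2 <= a * c.
Proof.
move=> c0 abc; have [cE|cN0] := eqVneq c 0.
  rewrite cE mulr0; have [-> //|bN0] := eqVneq b 0; first by rewrite expr0n.
  have bE : 2 * ((a + 1) / (2 * b)) * b = a + 1 by field.
  by have := abc ((a + 1) / (2 * b)); rewrite bE cE mulr0; lra.
have := abc (b / c).
have -> : a - 2 * (b / c) * b + (b / c) ^+ 2 * c = a - b ^+ 2 / c by field.
by rewrite subr_ge0 ler_pdivrMr// lt_def cN0.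
Qed.

Lemma sum_cauchy_schwarz (R : realFieldType) (I : Type) (r : seq I) (P : pred I)
    (a b : I -> R) :
  (\sum_(i <- r | P i) a i * b i) ^+ 2 <=
  (\sum_(i <- r | P i) a i ^+ 2) * (\sum_(i <- r | P i) b i ^+ 2).
Proof.
apply: sqr_le_of_nonneg_quadratic => [|t].
  by apply: sumr_ge0 => i _; exact: sqr_ge0.
rewrite !mulr_sumr -sumrB -big_split/=; apply: sumr_ge0 => i _.
have -> : a i ^+ 2 - 2 * t * (a i * b i) + t ^+ 2 * b i ^+ 2 = (a i - t * b i) ^+ 2.
  by ring.
exact: sqr_ge0.
Qed.

(** The integral of a nonnegative function is a supremum over measurable simple
    functions below it, and such a function may be set to zero on a null set
    without changing its integral. *)
Section integral_of_versions.
Import HBNNSimple.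
Context (d : measure_display) (T : measurableType d) (R : realType).
Variable mu : {measure set T -> \bar R}.
Local Open Scope ereal_scope.

Let ge0_ae_eq_le (f g : T -> \bar R) : (forall x, 0 <= f x) ->
  (forall x, 0 <= g x) -> ae_eq mu [set: T] f g ->
  \int[mu]_x f x <= \int[mu]_x g x.
Proof.
move=> f0 g0 [B [mB B0 fgB]]; rewrite !ge0_integralTE//.
apply: ge_ereal_sup => /= _ [s /= sf <-].
have mC := measurableC mB.
have sCE x : proj_nnsfun s mC x = (s \_ (~` B)) x by rewrite mrestrict.
apply: ereal_sup_ubound; exists (proj_nnsfun s mC) => /= [x|].
  rewrite [X in X%:E]sCE patchE; case: ifPn => [|_]; last exact: g0.
  rewrite inE => xB.
  have <- : f x = g x by apply: contrapT => fgx; apply: xB; apply: fgB => /(_ I).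
  exact: sf.
rewrite -!integralT_nnsfun; apply: ae_eq_integral => //.
- by apply/measurable_EFinP.
- by apply/measurable_EFinP.
exists B; split=> // x /=; apply: contra_notP => xB _.
by rewrite [X in X%:E = _]sCE patchE mem_set.
Qed.

Lemma integral_version (f g : T -> \bar R) : ae_eq mu [set: T] f g ->
  \int[mu]_x f x = \int[mu]_x g x.
Proof.
move=> /ae_eq_funeposneg[fgp fgn]; rewrite integralE [RHS]integralE.
by congr (_ - _); apply/eqP; rewrite eq_le !ge0_ae_eq_le//; apply: ae_eq_sym.
Qed.

End integral_of_versions.

(** This is Cauchy-Schwarz against the constant 1, obtained from
    [0 <= int (h - t) ^+ 2] for every [t]. *)
Lemma integral_le_sqrt (d : measure_display) (T : measurableType d)
    (R : realType) (mu : {measure set T -> \bar R}) (h : T -> R) (S : R) :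
  (mu [set: T] < +oo)%E -> measurable_fun [set: T] h ->
  (\int[mu]_x (h x ^+ 2)%:E <= S%:E)%E ->
  mu.-integrable [set: T] (EFin \o h) /\
  \int[mu]_x h x <= Num.sqrt (fine (mu [set: T])) * Num.sqrt S.
Proof.
move=> mu_fin mh hS.
have mu_num : mu [set: T] \is a fin_num by rewrite ge0_fin_numE.
have int_cst (r : R) : mu.-integrable [set: T] (EFin \o (fun=> r)).
  apply: measurable_bounded_integrable => //.
  exact: bounded_cst.
have int_h2 : mu.-integrable [set: T] (EFin \o (fun x => h x ^+ 2)).
  apply/integrableP; split.
    by apply/measurable_EFinP; exact: measurable_funX.
  under eq_integral do rewrite /= ger0_norm ?sqr_ge0//.
  exact: le_lt_trans hS (ltry _).
have int_h : mu.-integrable [set: T] (EFin \o h).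
  apply: (@le_integrable _ _ _ mu _ measurableT _ (EFin \o (fun x => 1 + h x ^+ 2))).
  - exact/measurable_EFinP.
  - move=> x _ /=; rewrite lee_fin [leRHS]ger0_norm ?addr_ge0 ?sqr_ge0//.
    by rewrite -(real_normK (num_real (h x))); have := sqr_ge0 (`|h x| - 1); nra.
  - exact: (integrableD measurableT (int_cst 1) int_h2).
split=> //.
have S2 : \int[mu]_x (h x ^+ 2) <= S.
  by rewrite -lee_fin /Rintegral fineK ?integrable_fin_num.
have S0 : 0 <= S.
  by apply: le_trans S2; apply: Rintegral_ge0 => x _; exact: sqr_ge0.
have m0 : 0 <= fine (mu [set: T]) by rewrite fine_ge0.
apply: le_trans (ler_norm _) _; rewrite -sqrtr_sqr -sqrtrM//.
rewrite ler_wsqrtr// mulrC; apply: sqr_le_of_nonneg_quadratic => // t.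
have : 0 <= \int[mu]_x (h x - t) ^+ 2.
  by apply: Rintegral_ge0 => x _; exact: sqr_ge0.
have sqrE x : (h x - t) ^+ 2 = h x ^+ 2 - 2 * t * h x + t ^+ 2 by ring.
under eq_Rintegral do rewrite sqrE.
have int_th : mu.-integrable [set: T] (EFin \o (fun x => 2 * t * h x)).
  exact: (integrableZl measurableT (2 * t) int_h).
rewrite RintegralD//; last exact: (integrableB measurableT int_h2 int_th).
rewrite RintegralB// RintegralZl// Rintegral_cst//; lra.
Qed.

(** * The error of the quadrature on the class *)

(** Nodes can be kept in a set of full measure by setting the functions to zero
    outside it: a node there contributes nothing, so its weight can be dropped. *)
Lemma approximate_tchakaloff_ae (R : realType) (d : measure_display)
    (T : measurableType d) (mu : {measure set T -> \bar R}) (n : nat)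
    (phi : 'I_n -> T -> R) (G : set T) (eps : R) :
  (forall k, mu.-integrable [set: T] (EFin \o phi k)) ->
  {ae mu, forall x, G x} -> 0 < eps ->
  exists (x : 'I_n -> T) (w : 'I_n -> R),
    [/\ forall j, 0 <= w j, forall j, w j = 0 \/ G (x j) &
    forall k, `|\int[mu]_y phi k y - \sum_j w j * phi k (x j)| <= eps].
Proof.
move=> phi_int [B [mB B0 GB]] eps0.
have mC := measurableC mB.
pose one_G y : R := \1_(~` B) y.
have psi_int k : mu.-integrable [set: T] (EFin \o (fun y => one_G y * phi k y)).
  apply: (@le_integrable _ _ _ mu _ measurableT _ (EFin \o phi k)) => //.
    apply/measurable_EFinP; apply: measurable_funM; first exact: measurable_indic.
    exact/measurable_EFinP/measurable_int/phi_int.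
  move=> y _ /=; rewrite lee_fin normrM ler_piMl// /one_G indicE.
  by case: (_ \in _); rewrite ?normr1 ?normr0.
have [x [w [w0 wE]]] := approximate_tchakaloff psi_int eps0.
exists x, (fun j => w j * one_G (x j)); split=> [j|j|k].
- by rewrite mulr_ge0// /one_G indicE.
- rewrite /one_G indicE; have [xB|xB] := pselect (B (x j)).
    by left; rewrite memNset ?mulr0//= => /(_ xB).
  by right; apply: contrapT => xG; apply: xB; exact: GB.
- under eq_bigr do rewrite -mulrA.
  suff <- : \int[mu]_y (one_G y * phi k y) = \int[mu]_y phi k y by [].
  congr fine; apply: integral_version; exists B; split=> // y /=.
  by apply: contra_notP => yB _; rewrite /one_G indicE mem_set// mul1r.
Qed.

(** One of the [m.+1] moments is spent on the dominating function [h]: being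
    nearly exact on [h] bounds the part of [f] that the [psi i] do not capture,
    in the quadrature as well as in the integral.  The nodes and weights do not
    depend on [f], so the bound is uniform over a class. *)
Lemma dominated_quadrature (R : realType) (d : measure_display)
    (T : measurableType d) (mu : {measure set T -> \bar R}) (m : nat)
    (h : T -> R) (psi : 'I_m -> T -> R) (G : set T) (eps : R) :
  mu.-integrable [set: T] (EFin \o h) ->
  (forall k, mu.-integrable [set: T] (EFin \o psi k)) ->
  {ae mu, forall x, G x} -> 0 < eps ->
  exists (x : 'I_m.+1 -> T) (w : 'I_m.+1 -> R), (forall j, 0 <= w j) /\
    forall (f fm : T -> R) (c : 'I_m -> R),
      mu.-integrable [set: T] (EFin \o fm) -> ae_eq mu [set: T] f fm ->
      (forall y, G y -> `|f y - \sum_i c i * psi i y| <= h y) ->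
      (`| \int[mu]_y (f y)%:E - (\sum_j w j * f (x j))%:E |
        <= (2 * \int[mu]_y h y + eps * (1 + \sum_i `|c i|))%:E)%E.
Proof.
move=> h_int psi_int G_ae eps0.
pose phi k := oapp psi h (unlift (@ord0 m) k).
have phi_int k : mu.-integrable [set: T] (EFin \o phi k).
  by rewrite /phi; case: unlift.
have [x [w [w0 wG wE]]] := approximate_tchakaloff_ae phi_int G_ae eps0.
exists x, w; split=> // f fm c fm_int f_fm f_h.
have hE : `|\int[mu]_y h y - \sum_j w j * h (x j)| <= eps.
  by have := wE ord0; rewrite /phi unlift_none.
have psiE i : `|\int[mu]_y psi i y - \sum_j w j * psi i (x j)| <= eps.
  by have := wE (lift ord0 i); rewrite /phi liftK.
have cpsi_int i : mu.-integrable [set: T] (EFin \o (fun y => c i * psi i y)).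
  exact: (integrableZl measurableT (c i) (psi_int i)).
have sum_int := integrable_sum_EFin (index_enum 'I_m) cpsi_int.
pose r y := fm y - \sum_i c i * psi i y.
have r_int : mu.-integrable [set: T] (EFin \o r).
  exact: (integrableB measurableT fm_int sum_int).
have int_r : `|\int[mu]_y r y| <= \int[mu]_y h y.
  apply: le_trans (le_normr_Rintegral measurableT r_int) _.
  have nr_int := integrable_norm r_int.
  have rh : {ae mu, forall y, [set: T] y -> (`|r y|%:E <= `|h y|%:E)%E}.
    apply: filterS2 G_ae f_fm => y Gy /(_ I) fy _.
    by rewrite lee_fin /r -fy (le_trans (f_h y Gy)) ?ler_norm.
  have h0 : {ae mu, forall y, [set: T] y -> (`|h y|%:E = (h y)%:E)%E}.
    apply: filterS G_ae => y Gy _.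
    by rewrite ger0_norm ?(le_trans _ (f_h y Gy)).
  have -> : \int[mu]_y h y = \int[mu]_y `|h y|.
    by congr fine; apply: esym; exact: integral_version.
  rewrite -lee_fin /Rintegral !fineK ?integrable_fin_num ?integrable_norm//.
  apply: ae_ge0_le_integral => //.
  - exact: measurable_int nr_int.
  - exact: measurable_int (integrable_norm h_int).
have sum_r : `|\sum_j w j * (f (x j) - \sum_i c i * psi i (x j))| <=
    \sum_j w j * h (x j).
  apply: le_trans (ler_norm_sum _ _ _) _; apply: ler_sum => j _.
  have [->|xG] := wG j; first by rewrite !mul0r normr0.
  by rewrite normrM ger0_norm// ler_wpM2l// f_h.
have -> : (\int[mu]_y (f y)%:E = (\int[mu]_y fm y)%:E)%E.
  rewrite /Rintegral fineK ?integrable_fin_num//.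
  by apply: integral_version; exact: (ae_eq_comp EFin).
rewrite -EFinB lee_fin.
have -> : \int[mu]_y fm y = \int[mu]_y r y + \sum_i c i * \int[mu]_y psi i y.
  rewrite RintegralB// Rintegral_sum//.
  under eq_bigr do rewrite RintegralZl//.
  by rewrite subrK.
have -> : \sum_j w j * f (x j) = \sum_j w j * (f (x j) - \sum_i c i * psi i (x j))
    + \sum_i c i * \sum_j w j * psi i (x j).
  under [X in _ + X]eq_bigr do rewrite mulr_sumr.
  rewrite exchange_big -big_split/=; apply: eq_bigr => j _.
  under [X in _ + X]eq_bigr do rewrite mulrCA.
  by rewrite -mulr_sumr -mulrDr subrK.
have cE : `|\sum_i c i * \int[mu]_y psi i y - \sum_i c i * \sum_j w j * psi i (x j)|
    <= eps * \sum_i `|c i|.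
  rewrite -sumrB mulr_sumr; apply: le_trans (ler_norm_sum _ _ _) _.
  by apply: ler_sum => i _; rewrite -mulrBr normrM mulrC ler_wpM2r.
move: int_r sum_r cE hE; rewrite !ler_norml.
move=> /andP[? ?] /andP[? ?] /andP[? ?] /andP[? ?].
by apply/andP; split; lra.
Qed.

(** Cauchy-Schwarz on the partial sums, with [c j * eta j x] split as
    [(c j / sigma j) * (sigma j * eta j x)]. *)
Lemma series_tail_bound (T : Type) (R : realType) (sigma : nat -> R)
    (eta : nat -> T -> R) (rep : (nat -> R) -> T -> R) (c : nat -> R) (x : T)
    (n : nat) :
  fixes_representatives sigma eta rep -> coef_ball sigma c ->
  good_points sigma eta x ->
  `|rep c x - \sum_(0 <= j < n | supp_idx sigma j) c j * eta j x| <=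
  Num.sqrt (fine (\sum_(n <= j <oo | supp_idx sigma j)
                     (sigma j ^+ 2 * eta j x ^+ 2)%:E)%E).
Proof.
move=> rep_sum cB x_good; set a := \sum_(0 <= j < n | _) _; set K := Num.sqrt _.
have term0 j : (0 <= (sigma j ^+ 2 * eta j x ^+ 2)%:E)%E.
  by rewrite lee_fin mulr_ge0 ?sqr_ge0.
have tail_fin : (\sum_(n <= j <oo | supp_idx sigma j)
    (sigma j ^+ 2 * eta j x ^+ 2)%:E)%E \is a fin_num.
  rewrite ge0_fin_numE; last by apply: nneseries_ge0 => j _ _.
  apply: le_lt_trans x_good.
  rewrite (@nneseries_split_cond _
    (fun j => (sigma j ^+ 2 * eta j x ^+ 2)%:E) 0 n)//.
  by rewrite add0n leeDr// sume_ge0.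
have cv : `|(\sum_(0 <= j < m | supp_idx sigma j) c j * eta j x) - a| @[m --> \oo]
    --> `|rep c x - a|.
  by apply: cvg_norm; apply: cvgB; [exact: rep_sum | exact: cvg_cst].
rewrite -(cvg_lim _ cv)//; apply: limr_le; first by apply/cvg_ex; eexists; exact: cv.
near=> m; have nm : (n <= m)%N by near: m; exact: nbhs_infty_ge.
rewrite (big_cat_nat _ nm)//= addrAC subrr add0r -sqrtr_sqr ler_wsqrtr//.
have -> : \sum_(n <= j < m | supp_idx sigma j) c j * eta j x =
    \sum_(n <= j < m | supp_idx sigma j) (c j / sigma j) * (sigma j * eta j x).
  by apply: eq_bigr => j /andP[_ sj]; rewrite mulrA divfK ?gt_eqF.
apply: le_trans (sum_cauchy_schwarz _ _ _ _) _.
rewrite -[leRHS]mul1r; apply: ler_pM.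
- by apply: sumr_ge0 => j _; exact: sqr_ge0.
- by apply: sumr_ge0 => j _; exact: sqr_ge0.
- rewrite -lee_fin; apply: le_trans cB.2.
  rewrite -sumEFin; apply: le_trans (nneseries_lim_ge m _); last first.
    by move=> j _ _; rewrite lee_fin sqr_ge0.
  rewrite (@big_cat_nat _ _ _ n 0 m)//= leeDr// sume_ge0// => j _.
  by rewrite lee_fin sqr_ge0.
- rewrite -lee_fin fineK// -sumEFin.
  under eq_bigr do rewrite exprMn.
  by apply: nneseries_lim_ge.
Unshelve. all: by end_near. Qed.

Lemma coef_ball_le (R : realType) (sigma c : nat -> R) (j : nat) :
  coef_ball sigma c -> 0 <= sigma j -> `|c j| <= sigma j.
Proof.
move=> [c_supp c_le1] sj0.
have [jJ|jJ] := boolP (supp_idx sigma j); last by rewrite c_supp// normr0.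
have sj : 0 < sigma j by case/andP: jJ.
have term0 i : supp_idx sigma i -> (0 <= ((c i / sigma i) ^+ 2)%:E)%E.
  by rewrite lee_fin sqr_ge0.
have : (((c j / sigma j) ^+ 2)%:E <= 1)%E.
  apply: le_trans c_le1; rewrite (nneseriesD1 term0 jJ) leeDl//.
  by apply: nneseries_ge0 => i _ /andP[/term0].
rewrite lee_fin -(real_normK (num_real _)) expr_le1// normrM normfV.
by rewrite (gtr0_norm sj) ler_pdivrMr// mul1r.
Qed.

Section nneseries_cond.
Context (d : measure_display) (T : measurableType d) (R : realType).
Variables (mu : {measure set T -> \bar R}) (f : nat -> T -> \bar R).
Variables (P : pred nat) (N : nat).
Local Open Scope ereal_scope.
Hypothesis mf : forall j, measurable_fun [set: T] (f j).
Hypothesis f0 : forall j x, 0 <= f j x.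

Lemma measurable_nneseries_cond :
  measurable_fun [set: T] (fun x => \sum_(N <= j <oo | P j) f j x).
Proof.
under eq_fun do rewrite eseries_cond.
exact: (ge0_emeasurable_sum (P := fun j => P j && (N <= j)%N)).
Qed.

Lemma integral_nneseries_cond :
  \int[mu]_x (\sum_(N <= j <oo | P j) f j x) =
  \sum_(N <= j <oo | P j) \int[mu]_x f j x.
Proof.
have fP j : measurable_fun [set: T]
    (fun x => if P j && (N <= j)%N then f j x else 0)
  by case: (P j && (N <= j)%N).
rewrite [RHS]eseries_cond [RHS]eseries_mkcond.
under eq_integral do rewrite eseries_cond eseries_mkcond.
rewrite (integral_nneseries mu measurableT fP); last by move=> j x _; case: ifP.
by apply: eq_eseriesr => j _; case: (P j && _); rewrite ?integral0.
Qed.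

End nneseries_cond.

(** The conclusion is conditional on [J j] and holds for every [j], so that a
    whole sequence of versions can be chosen at once. *)
Lemma orthonormal_version (d : measure_display) (T : measurableType d)
    (R : realType) (mu : {measure set T -> \bar R}) (J : pred nat)
    (eta : nat -> T -> R) (j : nat) :
  (mu [set: T] < +oo)%E -> orthonormal_system mu J eta ->
  exists g : T -> R,
    [/\ measurable_fun [set: T] g, mu.-integrable [set: T] (EFin \o g),
        {ae mu, forall y, J j -> eta j y = g y} &
        J j -> (\int[mu]_y (g y ^+ 2)%:E = 1)%E].
Proof.
move=> mu_fin [eta_L2 eta_on]; have [jJ|jJ] := boolP (J j); last first.
  exists (fun=> 0); split=> //; first exact: integrable0.
  by apply: aeW => y.
have [g g_L2 eta_g] := eta_L2 j jJ.
have mu_num : mu [set: T] \is a fin_num by rewrite ge0_fin_numE.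
exists g; split.
- by have := sub_Lfun_mfun g_L2; rewrite inE.
- exact/Lfun1_integrable/(Lfun_subset12 mu_num).
- by apply: filterS eta_g => y /(_ I).
move=> _; have := eta_on j j jJ jJ; rewrite eqxx => <-.
apply: esym; apply: integral_version.
by apply: filterS eta_g => y /(_ I) -> _; rewrite expr2.
Qed.

Theorem theorem4p3 (R : realType) (d : measure_display) (T : measurableType d)
    (mu : {measure set T -> \bar R}) (mu_fin : (mu [set: T] < +oo)%E)
    (sigma : nat -> R)
    (sigma_ge0 : forall j, (0 < j)%N -> 0 <= sigma j)
    (sigma_noninc : forall i j, (0 < i)%N -> (i <= j)%N -> sigma j <= sigma i)
    (sigma_l2 : (\sum_(1 <= j <oo) (sigma j ^+ 2)%:E < +oo)%E)
    (eta : nat -> T -> R)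
    (eta_orthonormal : orthonormal_system mu (supp_idx sigma) eta)
    (rep : (nat -> R) -> T -> R)
    (rep_sum : fixes_representatives sigma eta rep)
    (N : set T) (N_null : mu.-negligible N)
    (Nf : (T -> R) -> set (T -> R))
    (Nf_null : forall f g, class0 sigma rep f -> Nf f g ->
       mu_measurable mu g /\ (forall x, ~ N x -> g x = 0))
    (F_L2 : perturbed_class (class0 sigma rep) Nf `<=` L2fun mu)
    (n : nat) (n_gt0 : (0 < n)%N) :
  (tchakaloff_width mu (perturbed_class (class0 sigma rep) Nf) n <=
   (2 * Num.sqrt (fine (mu [set: T]))
      * Num.sqrt (fine (\sum_(n <= j <oo) (sigma j ^+ 2)%:E)%E))%:E)%E.
Proof.
(* [m] of the [m.+1] nodes account for [eta_1, ..., eta_m], the last for [h]. *)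
case: n n_gt0 => // m _.
pose J := supp_idx sigma.
have mu_num : mu [set: T] \is a fin_num by rewrite ge0_fin_numE.
have [g /all_and4[mg g_int eta_g g_norm]] :=
  choice (fun j => orthonormal_version j mu_fin eta_orthonormal).
pose term j y : \bar R := (sigma j ^+ 2 * g j y ^+ 2)%:E.
have term0 j y : (0 <= term j y)%E by rewrite lee_fin mulr_ge0 ?sqr_ge0.
have sqr0 j : (0 <= (sigma j ^+ 2)%:E)%E by rewrite lee_fin sqr_ge0.
have mterm j : measurable_fun [set: T] (term j).
  apply/measurable_EFinP; apply: measurable_funM => //.
  exact: measurable_funX.
have int_kernel M : (\int[mu]_y (\sum_(M <= j <oo | J j) term j y) =
    \sum_(M <= j <oo | J j) (sigma j ^+ 2)%:E)%E.
  rewrite integral_nneseries_cond//.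
  rewrite eseries_mkcond [RHS]eseries_mkcond; apply: eq_eseriesr => j _.
  case: ifPn => // jJ; rewrite /term; under eq_integral do rewrite EFinM.
  rewrite ge0_integralZl//; first by rewrite g_norm// mule1.
  - by apply/measurable_EFinP; exact: measurable_funX.
  - by move=> y _; rewrite lee_fin sqr_ge0.
have tail_le M : (\sum_(M <= j <oo | J j) (sigma j ^+ 2)%:E <=
    \sum_(1 <= j <oo) (sigma j ^+ 2)%:E)%E.
  rewrite eseries_cond [leRHS]eseries_cond; apply: subset_lee_nneseries => //.
  by move=> j /andP[/andP[]].
pose S := fine (\sum_(m.+1 <= j <oo) (sigma j ^+ 2)%:E)%E.
have S_le : (\sum_(m.+1 <= j <oo | J j) (sigma j ^+ 2)%:E <= S%:E)%E.
  rewrite fineK; first exact: subset_lee_nneseries.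
  rewrite ge0_fin_numE; last exact: nneseries_ge0.
  apply: le_lt_trans sigma_l2.
  rewrite eseries_cond [leRHS]eseries_cond; apply: subset_lee_nneseries => //.
  by move=> j; exact: leq_ltn_trans.
(* [h] is only meaningful where the kernel is finite; elsewhere [fine] makes it
   0, which keeps the bound on its L_2 norm. *)
pose h y := Num.sqrt (fine (\sum_(m.+1 <= j <oo | J j) term j y)%E).
have mh : measurable_fun [set: T] h.
  apply: (measurableT_comp (continuous_measurable_fun (@sqrt_continuous R))) => //.
  apply: (measurableT_comp (fine_measurable measurableT)) => //.
  exact: measurable_nneseries_cond.
have h2_le : (\int[mu]_y (h y ^+ 2)%:E <= S%:E)%E.
  apply: le_trans S_le; rewrite -int_kernel; apply: ge0_le_integral => //.
  - by move=> y _; rewrite lee_fin sqr_ge0.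
  - by apply/measurable_EFinP; exact: measurable_funX.
  - exact: measurable_nneseries_cond.
  - move=> y _; rewrite /h sqr_sqrtr; last first.
      by rewrite fine_ge0// nneseries_ge0.
    have : (0 <= \sum_(m.+1 <= j <oo | J j) term j y)%E by exact: nneseries_ge0.
    by case: (\sum_(_ <= j <oo | J j) _)%E => //= r _; rewrite leey.
have [h_int int_h] := integral_le_sqrt mu_fin mh h2_le.
pose G y := [/\ forall j, J j -> eta j y = g j y, ~ N y &
  good_points sigma eta y].
have G_ae : {ae mu, forall y, G y}.
  have kernel_int : mu.-integrable [set: T]
      (fun y => \sum_(0 <= j <oo | J j) term j y)%E.
    apply/integrableP; split; first exact: measurable_nneseries_cond.
    under eq_integral do rewrite gee0_abs ?nneseries_ge0//.
    rewrite int_kernel; exact: le_lt_trans (tail_le _) sigma_l2.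
  have N_ae : {ae mu, forall y, ~ N y}.
    by apply: negligibleS N_null => y /contrapT.
  apply: filterS3 (ae_foralln eta_g) N_ae (integrable_ae measurableT kernel_int).
  move=> y eta_gy Ny /(_ I); rewrite ge0_fin_numE ?nneseries_ge0// => fin_y.
  split=> //; rewrite /good_points/=.
  by rewrite (@eq_eseriesr _ _ (fun j => term j y))// => j jJ; rewrite eta_gy.
(* The width being an infimum, an additive error [e] is allowed; [M] bounds
   [1 + sum |c_j|] over the class and so fixes the accuracy [e / M]. *)
apply/lee_addgt0Pr => e e0.
have s1 : 0 <= sigma 1%N by exact: sigma_ge0.
pose M := 1 + sigma 1%N *+ m.
have M0 : 0 < M by rewrite ltr_pwDl// mulrn_wge0.
have [x [w [w0 xw]]] := dominated_quadrature h_int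
  (fun i : 'I_m => g_int i.+1) G_ae (divr_gt0 e0 M0).
apply: le_trans (ereal_inf_lbound _) _; first by exists x, w; split.
apply: ge_ereal_sup => _ [_ [_ [c cB <-] [g0 Nfg0 <-]] <-].
have f_L2 : L2fun mu (rep c \+ g0).
  by apply: F_L2; exists (rep c); [exists c | exists g0].
have [fm fm_L2 f_fm] := f_L2.
have g0_null y : ~ N y -> g0 y = 0.
  by apply: (Nf_null (rep c) g0 _ Nfg0).2; exists c.
apply: le_trans (xw _ fm (fun i : 'I_m => c i.+1) _ f_fm _) _.
- exact/Lfun1_integrable/(Lfun_subset12 mu_num).
- move=> y [eta_gy Ny y_good]; rewrite /= g0_null// addr0.
  have := series_tail_bound m.+1 rep_sum cB y_good.
  rewrite (@eq_eseriesr _ _ (fun j => term j y)) => [|j jJ]; last by rewrite eta_gy.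
  rewrite -/J -/(h y).
  suff -> : \sum_(0 <= j < m.+1 | J j) c j * eta j y =
    \sum_(i < m) c i.+1 * g i.+1 y by [].
  have J0 : J 0%N = false by [].
  rewrite big_mkcond big_nat_recl// J0/= add0r big_mkord.
  apply: eq_bigr => i _; case: ifPn => iJ; first by rewrite eta_gy.
  by rewrite cB.1// mul0r.
- have c_le : 1 + \sum_(i < m) `|c i.+1| <= M.
    rewrite lerD2l -[X in _ *+ X](card_ord m) -sumr_const; apply: ler_sum => i _.
    apply: le_trans (coef_ball_le cB (sigma_ge0 _ _)) _ => //.
    exact: sigma_noninc.
  rewrite -EFinD lee_fin -mulrA lerD ?ler_wpM2l//.
  by rewrite mulrAC ler_pdivrMr// ler_pM2l.
Qed.
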